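(* For an arbitrary positive integer $n$ the semigroup $\mathscr{IPF}(\mathbb{N}^n)$ is an $F$-inverse semigroup.
   Context: $\mathbb{N}$ is the set of positive integers; $(\mathbb{N}^n,\leqslant)$ carries the product (coordinatewise) order; ${\uparrow}\mathbf{x}=\{\mathbf{y}\in\mathbb{N}^n:\mathbf{x}\leqslant\mathbf{y}\}$ is the principal filter generated by $\mathbf{x}$. $\mathscr{IPF}(\mathbb{N}^n)$ is the semigroup of all order isomorphisms between principal filters of $(\mathbb{N}^n,\leqslant)$, with composition of partial maps (maps written on the right, composed left to right, $z(\alpha\beta)=(z\alpha)\beta$ wherever defined). The natural partial order on an inverse semigroup $S$ is: $a\preccurlyeq b$ iff there is an idempotent $e\in S$ with $a=be$. The least group congruence $\mathfrak{C}_{\mathbf{mg}}$ on $S$ is: $s\,\mathfrak{C}_{\mathbf{mg}}\,t$ iff there is an idempotent $e\in S$ with $se=te$. An inverse semigroup $S$ is $F$-inverse if the $\mathfrak{C}_{\mathbf{mg}}$-class of each element of $S$ has a greatest element with respect to the natural partial order on $S$. *)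

(* Defs.v *)
From HB Require Import structures.
From mathcomp Require Import all_boot all_order.
From mathcomp Require Import boolp classical_sets.

Set Implicit Arguments.
Unset Strict Implicit.
Unset Printing Implicit Defensive.

Import Order.TTheory.
Local Open Scope classical_set_scope.
Local Open Scope order_scope.
Local Open Scope group_scope.

Definition idempotent_elt (S : semigroupType) (e : S) : Prop := e * e = e.

Definition inverse_of (S : semigroupType) (a b : S) : Prop :=
  a * b * a = a /\ b * a * b = b.

Definition inverse_semigroup (S : semigroupType) : Prop :=
  forall a : S, exists! b : S, inverse_of a b.

Definition natural_le (S : semigroupType) (a b : S) : Prop :=
  exists2 e : S, idempotent_elt e & a = b * e.

(* When S is inverse, this is the least congruence whose quotient is a group. *)
Definition Cmg (S : semigroupType) (s t : S) : Prop :=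
  exists2 e : S, idempotent_elt e & s * e = t * e.

Definition natural_greatest (S : semigroupType) (A : set S) (m : S) : Prop :=
  A m /\ forall t, A t -> natural_le t m.

Definition F_inverse_semigroup (S : semigroupType) : Prop :=
  inverse_semigroup S /\
  forall s : S, exists m : S, natural_greatest [set t | Cmg s t] m.

Section PartialMaps.
Context {d : Order.disp_t} {T : porderType d}.
Implicit Types (x y : T) (A B : set T) (f : T -> option T).

Definition principal_filter x : set T := [set y | x <= y].

(* A partial map is a function f : T -> option T, with f z = None when f is
   undefined at z. *)
Definition pdom f : set T := [set z | exists w, f z = Some w].
Definition pran f : set T := [set w | exists z, f z = Some w].

Definition order_iso_between A B f : Prop :=
  [/\ pdom f = A, pran f = B,
      forall z1 z2 w, f z1 = Some w -> f z2 = Some w -> z1 = z2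
    & forall z1 z2 w1 w2, f z1 = Some w1 -> f z2 = Some w2 ->
        (z1 <= z2) = (w1 <= w2)].

Definition principal_filter_iso f : Prop :=
  exists x y, order_iso_between (principal_filter x) (principal_filter y) f.

End PartialMaps.

Record IPF {d : Order.disp_t} (T : porderType d) := MkIPF {
  ipf_map :> T -> option T;
  ipf_mapP : principal_filter_iso ipf_map
}.

Lemma ipf_eq {d : Order.disp_t} {T : porderType d} (a b : IPF T) :
  ipf_map a =1 ipf_map b -> a = b.
Proof.
case: a b => [f fP] [g gP] /= /funext efg; subst g.
by congr MkIPF; exact: Prop_irrelevance.
Qed.

HB.instance Definition _ {d : Order.disp_t} (T : porderType d) :=
  gen_eqMixin (IPF T).
HB.instance Definition _ {d : Order.disp_t} (T : porderType d) :=
  gen_choiceMixin (IPF T).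

Section Composition.
Context {d : Order.disp_t} {T : joinSemilatticeType d}.

(* Maps are written on the right: z (a b) = (z a) b.  Binary joins in T make
   the intersection of two principal filters principal, so composition does
   not leave the class of order isomorphisms of principal filters. *)
Lemma pcomp_filter_iso (f g : T -> option T) :
  principal_filter_iso f -> principal_filter_iso g ->
  principal_filter_iso (pcomp g f).
Proof.
have pcompE z w : pcomp g f z = Some w ->
    exists2 u, f z = Some u & g u = Some w.
  by rewrite /pcomp /=; case: (f z) => //= u gu; exists u.
move=> [x [y [df rf If Of]]] [x' [y' [dg rg Ig Og]]].
have: pran f (y `|` x') by rewrite rf /principal_filter /= leUl.
move=> [a fa].
have: pdom g (y `|` x') by rewrite dg /principal_filter /= leUr.
move=> [b gb].
exists a, b; split.
- apply/seteqP; split => z /=.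
  + move=> [w /pcompE[u fz gu]].
    rewrite /principal_filter /= (Of _ _ _ _ fa fz) leUx.
    have -> /= : y <= u by have : pran f u by [exists z]; rewrite rf.
    by have : pdom g u by [exists w]; rewrite dg.
  + rewrite /principal_filter /= => az.
    have : pdom f z.
      have : pdom f a by exists (y `|` x').
      by rewrite df /principal_filter /= => /le_trans; exact.
    move=> [u fz]; move: az; rewrite (Of _ _ _ _ fa fz) leUx => /andP[_ xu].
    have : pdom g u by rewrite dg.
    by move=> [w gu]; exists w; rewrite /pcomp /= fz.
- apply/seteqP; split => w /=.
  + move=> [z /pcompE[u fz gu]].
    rewrite /principal_filter /= -(Og _ _ _ _ gb gu) leUx.
    have -> /= : y <= u by have : pran f u by [exists z]; rewrite rf.
    by have : pdom g u by [exists w]; rewrite dg.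
  + rewrite /principal_filter /= => bw.
    have : pran g w.
      have : pran g b by exists (y `|` x').
      by rewrite rg /principal_filter /= => /le_trans; exact.
    move=> [u gu]; move: bw; rewrite -(Og _ _ _ _ gb gu) leUx => /andP[yu _].
    have : pran f u by rewrite rf.
    by move=> [z fz]; exists z; rewrite /pcomp /= fz.
- move=> z1 z2 w /pcompE[u1 f1 g1] /pcompE[u2 f2 g2].
  by move: f2; rewrite -(Ig _ _ _ g1 g2); exact: If.
- move=> z1 z2 w1 w2 /pcompE[u1 f1 g1] /pcompE[u2 f2 g2].
  by rewrite (Of _ _ _ _ f1 f2); exact: Og.
Qed.

Definition ipf_mul (a b : IPF T) : IPF T :=
  MkIPF (pcomp_filter_iso (ipf_mapP a) (ipf_mapP b)).

Lemma ipf_mulA : associative ipf_mul.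
Proof. by move=> a b c; apply: ipf_eq => z /=; rewrite /pcomp /=; case: (a z). Qed.

End Composition.

HB.instance Definition _ {d : Order.disp_t} (T : joinSemilatticeType d) :=
  isSemigroup.Build (IPF T) ipf_mulA.

Fact posnat_display : Order.disp_t. Proof. exact: Order.Disp tt tt. Qed.

Definition posnat : Type := {m : nat | (0 < m)%N}.
HB.instance Definition _ := SubChoice.on posnat.
HB.instance Definition _ :=
  [SubChoice_isSubOrder of posnat by <: with posnat_display].

(* tupleprod carries the coordinatewise order *)
Definition posnat_pow (n : nat) := n.-tupleprod posnat.
HB.instance Definition _ n := Order.DistrLattice.on (posnat_pow n).

(* Main.v *)
Require Import Defs.
From mathcomp Require Import all_boot all_order.
From mathcomp Require Import boolp classical_sets zify.

(* After subtracting the least elements, an order isomorphism between principal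
   filters is an automorphism of the poset of vectors of natural numbers.  The
   multiples of the unit vectors are the elements whose lower set is a chain,
   so they are permuted, and they determine the automorphism: it permutes the
   coordinates.  Hence every element of the semigroup is a permutation of
   coordinates followed by an integer translation, restricted to a principal
   filter.  Two elements identified by the least group congruence agree on a
   principal filter, so they have the same permutation and the same
   translation; the map with these data and the largest possible domain, which
   is again a principal filter, is the greatest element of the class. *)

Set Implicit Arguments.
Unset Strict Implicit.
Unset Printing Implicit Defensive.

Import Order.TTheory.
Local Open Scope classical_set_scope.
Local Open Scope order_scope.
Local Open Scope group_scope.

(** * Order isomorphisms of principal filters in a join semilattice *)

Section FilterIso.
Context {d : Order.disp_t} {T : joinSemilatticeType d}.
Implicit Types (a b e : IPF T) (x z w : T).

Lemma mulIPF_Some a b z w : (a * b) z = Some w <->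
  exists2 u, a z = Some u & b u = Some w.
Proof.
rewrite /mul /= /pcomp /=; case az: (a z) => [u|] /=; split => //.
- by exists u.
- by move=> [_ [<-]].
- by move=> [].
Qed.

Lemma IPF_ext a b :
  (forall z w, a z = Some w <-> b z = Some w) -> a = b.
Proof.
move=> ab; apply: ipf_eq => z.
case az: (a z) => [w|]; first by have /ab -> := az.
by case bz: (b z) => [w|] //; have /ab := bz; rewrite az.
Qed.

Lemma IPF_inj a z1 z2 w : a z1 = Some w -> a z2 = Some w -> z1 = z2.
Proof. by have [x [y [_ _ inj _]]] := ipf_mapP a; exact: inj. Qed.

Lemma filter_id_iso x :
  principal_filter_iso (fun z => if x <= z then Some z else None).
Proof.
exists x, x; split.
- apply/seteqP; split => z; rewrite /pdom /principal_filter /=.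
    by move=> [w]; case: ifP.
  by move=> xz; exists z; rewrite xz.
- apply/seteqP; split => z; rewrite /pran /principal_filter /=.
    by move=> [w]; case: ifP => // xw [<-].
  by move=> xz; exists z; rewrite xz.
- by move=> z1 z2 w; case: ifP => // _ [->]; case: ifP => // _ [->].
- by move=> z1 z2 w1 w2; case: ifP => // _ [->]; case: ifP => // _ [->].
Qed.

Definition filter_id x : IPF T := MkIPF (filter_id_iso x).

Lemma filter_id_idempotent x : idempotent_elt (filter_id x).
Proof.
apply: IPF_ext => z w; rewrite mulIPF_Some /=; split.
  by move=> [u]; case xz: (x <= z) => // -[<-]; rewrite xz.
by case xz: (x <= z) => // -[<-]; exists z; rewrite ?xz.
Qed.

(** Idempotency makes [e] send [w] to [w], and injectivity then forces [z = w]. *)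
Lemma idempotent_IPF_id e z w :
  idempotent_elt e -> e z = Some w -> z = w.
Proof.
move=> ee ez; have : (e * e) z = Some w by rewrite ee.
by move=> /mulIPF_Some[u eu ew]; rewrite ez in eu; case: eu ew => <- /(IPF_inj ez).
Qed.

Definition pinv a w : option T :=
  if pselect (exists z, a z = Some w) is left ex
  then Some (projT1 (cid ex)) else None.

Lemma pinv_Some a z w : pinv a w = Some z <-> a z = Some w.
Proof.
rewrite /pinv; case: pselect => [ex|nex]; split => //.
- by move=> [<-]; case: (cid ex).
- by move=> az; congr Some; case: (cid ex) => z' /= /IPF_inj; apply.
- by move=> az; case: nex; exists z.
Qed.

Lemma pinv_iso a : principal_filter_iso (pinv a).
Proof.
have [x [y [da ra Ia Oa]]] := ipf_mapP a.
exists y, x; split.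
- rewrite -ra; apply/seteqP.
  by split => w [z /pinv_Some az]; exists z => //; exact/pinv_Some.
- rewrite -da; apply/seteqP.
  by split => w [z /pinv_Some az]; exists z => //; exact/pinv_Some.
- by move=> w1 w2 z /pinv_Some az /pinv_Some; rewrite az => -[].
- by move=> w1 w2 z1 z2 /pinv_Some a1 /pinv_Some a2; rewrite (Oa _ _ _ _ a1 a2).
Qed.

(** Evaluating [a * b * a = a] at [z] shows that [a] takes the value [w] at [b w] too, so
    injectivity applies. Used in both directions, this makes the graph of an inverse the converse
    graph, whence uniqueness. *)
Lemma inverse_of_Some a b z w :
  inverse_of a b -> a z = Some w -> b w = Some z.
Proof.
move=> [aba _] az; have : (a * b * a) z = Some w by rewrite aba.
move=> /mulIPF_Some[u /mulIPF_Some[v]].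
by rewrite az => -[<-] bw /(IPF_inj az) ->.
Qed.

Lemma IPF_inverse_semigroup : inverse_semigroup (IPF T).
Proof.
have invK a b : (forall z w, b w = Some z <-> a z = Some w) -> a * b * a = a.
  move=> ab; apply: IPF_ext => z w; rewrite mulIPF_Some; split.
    by move=> [u /mulIPF_Some[v /ab bv]]; rewrite bv => -[->].
  move=> az; exists z => //; apply/mulIPF_Some.
  by exists w => //; exact/ab.
move=> a; exists (MkIPF (pinv_iso a)); split.
  split; apply: invK => z w; first exact: pinv_Some.
  exact: iff_sym (pinv_Some _ _ _).
move=> b [aba bab]; apply: IPF_ext => w z; rewrite /= pinv_Some; split.
  exact: inverse_of_Some.
exact: (@inverse_of_Some b a).
Qed.

(** Restricting [b] to the domain of [a] amounts to following [b] by the identity on the range of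
    [a], because [b] is injective. *)
Lemma extension_natural_le a b :
  (forall z w, a z = Some w -> b z = Some w) -> natural_le a b.
Proof.
move=> ab; have [x [y [_ ra _ _]]] := ipf_mapP a.
exists (filter_id y); first exact: filter_id_idempotent.
apply: IPF_ext => z w; rewrite mulIPF_Some /=; split.
  move=> az; exists w; first exact: ab.
  suff -> : y <= w by [].
  by have : pran a w by [exists z]; rewrite ra.
move=> [u bz]; case: ifP => // yu [uw].
have : pran a u by rewrite ra.
move=> [z' az']; move: (az') => /ab /(IPF_inj bz) ->.
by rewrite az' uw.
Qed.

(** The idempotent [e] is a partial identity, so [a] and [b] agree wherever [a] lands in its domain.
    The witness [z0] is the preimage under [a] of the join of the least elements of the range of [a]
    and the domain of [e]. *)
Lemma Cmg_agree a b : Cmg a b ->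
  exists z0, forall z, z0 <= z -> exists2 w, a z = Some w & b z = Some w.
Proof.
move=> [e ee abe].
have [x [y [da ra _ Oa]]] := ipf_mapP a.
have [q [q' [de _ _ _]]] := ipf_mapP e.
have : pran a (y `|` q) by rewrite ra /principal_filter /= leUl.
move=> [z0 az0]; exists z0 => z z0z.
have : pdom a z.
  have : pdom a z0 by exists (y `|` q).
  by rewrite da /principal_filter /= => /le_trans; exact.
move=> [w az].
have : pdom e w.
  rewrite de /principal_filter /=; apply: (@le_trans _ _ (y `|` q)).
    exact: leUr.
  by rewrite -(Oa _ _ _ _ az0 az).
move=> [w' ew]; have ww' := idempotent_IPF_id ee ew; rewrite -ww' in ew.
exists w => //.
have : (b * e) z = Some w by rewrite -abe; apply/mulIPF_Some; exists w.
by move=> /mulIPF_Some[u bz /(idempotent_IPF_id ee) <-].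
Qed.

End FilterIso.

(** * Order automorphisms of vectors of natural numbers *)

Section NatVectors.
Variable n : nat.
Implicit Types (u v w : 'I_n -> nat) (i j : 'I_n) (k : nat).

Definition vle u v : Prop := forall i, (u i <= v i)%N.

Definition axis i k : 'I_n -> nat := fun j => if j == i then k else 0%N.

Definition below_chain u : Prop :=
  forall v w, vle v u -> vle w u -> vle v w \/ vle w v.

Lemma axis_vle i k u : vle (axis i k) u <-> (k <= u i)%N.
Proof.
split; first by move/(_ i); rewrite /axis eqxx.
by move=> ku j; rewrite /axis; case: eqP => // ->.
Qed.

Lemma vle_axis i k u : vle u (axis i k) -> u = axis i (u i).
Proof.
move=> uk; apply/funext => j; have := uk j; rewrite /axis.
by case: eqP => [->//|_]; rewrite leqn0 => /eqP.
Qed.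

Lemma axis_below_chain i k : below_chain (axis i k).
Proof.
move=> v w /vle_axis -> /vle_axis ->.
have [vw|/ltnW wv] := leqP (v i) (w i); [left|right];
  by apply/axis_vle; rewrite /axis eqxx.
Qed.

(** A second positive coordinate would put two incomparable unit vectors below [u]. *)
Lemma below_chain_axis i u : below_chain u -> (0 < u i)%N -> u = axis i (u i).
Proof.
move=> cu ui; apply/funext => j; rewrite /axis; case: (eqVneq j i) => [->//|ji].
have [|uj] := posnP (u j) => //.
have [] : vle (axis i 1) (axis j 1) \/ vle (axis j 1) (axis i 1).
- by apply: cu; exact/axis_vle.
- by move/axis_vle; rewrite /axis eq_sym (negPf ji).
- by move/axis_vle; rewrite /axis (negPf ji).
Qed.

Lemma nat_order_automorphism (h : nat -> nat) :
  (forall k l, (k <= l)%N = (h k <= h l)%N) -> (forall m, exists k, h k = m) ->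
  forall k, h k = k.
Proof.
move=> hle hsurj k; elim/ltn_ind: k => k IH.
have [l hl] := hsurj k.
have [lk|kl] := ltnP l k; first by have := IH _ lk; lia.
have [kh|hk] := leqP k (h k); first by move: kl; rewrite hle hl; lia.
(* If [h k < k], induction gives [h (h k) = h k], and reflecting the order yields [k <= h k], a
   contradiction. *)
by have := hle k (h k); rewrite (IH _ hk); lia.
Qed.

Section Automorphism.
Variable g : ('I_n -> nat) -> ('I_n -> nat).
Hypothesis g_vle : forall u v, vle u v <-> vle (g u) (g v).
Hypothesis g_surj : forall v, exists u, g u = v.

Let g_mono u v : vle u v -> vle (g u) (g v) := proj1 (g_vle u v).
Let vle_g u v : vle (g u) (g v) -> vle u v := proj2 (g_vle u v).

Let g_below_chain u : below_chain u -> below_chain (g u).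
Proof.
move=> cu v w; have [v' <-] := g_surj v; have [w' <-] := g_surj w.
move=> /vle_g v'u /vle_g w'u.
by have [/g_mono|/g_mono] := cu _ _ v'u w'u; [left|right].
Qed.

Let g0 i : g (axis i 0) = fun=> 0%N.
Proof.
have [u gu] := g_surj (fun=> 0%N); apply/funext => j.
have /g_mono : vle (axis i 0) u by exact/axis_vle.
by rewrite gu => /(_ j); rewrite leqn0 => /eqP.
Qed.

Let g_axis i : exists j, forall k, g (axis i k) = axis j k.
Proof.
(* The image of a unit vector is nonzero, since otherwise the unit vector would lie below zero. *)
have [j gj] : exists j, (0 < g (axis i 1) j)%N.
  apply/not_existsP => gle0.
  have : vle (g (axis i 1)) (g (axis i 0)).
    by move=> j; have := gle0 j; lia.
  by move=> /vle_g /axis_vle; rewrite /axis eqxx.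
exists j.
have gaxis k : g (axis i k) = axis j (g (axis i k) j).
  case: k => [|k]; first by rewrite g0; apply/funext => l; rewrite /axis; case: ifP.
  apply: below_chain_axis; first exact/g_below_chain/axis_below_chain.
  apply: leq_trans gj _.
  by have /g_mono : vle (axis i 1) (axis i k.+1) by apply/axis_vle; rewrite /axis eqxx.
pose h k := g (axis i k) j.
suff hk : forall k, h k = k by move=> k; rewrite gaxis [g _ j]hk.
apply: nat_order_automorphism => [k l|m].
  apply/idP/idP => [kl|].
    suff /g_mono/(_ j) : vle (axis i k) (axis i l) by [].
    by apply/axis_vle; rewrite /axis eqxx.
  move=> hkl; suff /axis_vle : vle (axis i k) (axis i l) by rewrite /axis eqxx.
  by apply/vle_g; rewrite gaxis [g (axis i l)]gaxis; apply/axis_vle; rewrite /axis eqxx.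
have [u gu] := g_surj (axis j m).
suff ui : u = axis i (u i) by exists (u i); rewrite /h -ui gu /axis eqxx.
(* Either [u] lies below the unit vector [axis i 1], or it lies above it and its lower set is a
   chain; both make it a multiple of that vector. *)
have [mh|hm] := leqP m (h 1%N).
  apply: (@vle_axis i 1); apply/vle_g; rewrite gu gaxis.
  by apply/axis_vle; rewrite /axis eqxx.
apply: below_chain_axis.
  move=> v w /g_mono vu /g_mono wu.
  have := @axis_below_chain j m (g v) (g w); rewrite -gu => /(_ vu wu).
  by move=> [/vle_g|/vle_g]; [left|right].
apply/axis_vle/vle_g; rewrite gu gaxis.
by apply/axis_vle; rewrite /axis eqxx ltnW.
Qed.

Lemma vector_automorphism_perm :
  exists2 r : 'I_n -> 'I_n, bijective r & forall u j, g u j = u (r j).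
Proof.
have [s gs] := choice g_axis.
have gus u i : g u (s i) = u i.
  (* A coordinate is determined by the multiples of its unit vector lying below [u], and [g] carries
     these to multiples of another unit vector. *)
  have leP k : (k <= u i)%N = (k <= g u (s i))%N.
    apply/idP/idP => /axis_vle.
      by move=> /g_mono; rewrite gs => /axis_vle.
    by rewrite -gs => /vle_g /axis_vle.
  by apply/eqP; rewrite eqn_leq leP leqnn -leP leqnn.
have s_inj : injective s.
  move=> i j sij; have : vle (axis i 1) (axis j 1) by apply/vle_g; rewrite !gs sij.
  by move/axis_vle; rewrite /axis; case: eqP.
have [r sr rs] := injF_bij s_inj.
exists r; first by exists s.
by move=> u j; rewrite -{1}(rs j) gus.
Qed.

End Automorphism.
End NatVectors.

(** * Permutations with translations on powers of the positive integers, and greatest elements *)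

Section PositivePowers.
Variable n : nat.
Implicit Types (x y z w : posnat_pow n) (u v : 'I_n -> nat).
Implicit Types (f a b : IPF (posnat_pow n)).

(* Coordinates are shifted by one, so that they range over all of nat. *)
Definition coords z : 'I_n -> nat := fun i => (val (tnth z i)).-1.

Definition of_coords u : posnat_pow n :=
  [tuple (exist _ (u i).+1 (ltn0Sn (u i)) : posnat) | i < n].

Lemma of_coordsK : cancel of_coords coords.
Proof. by move=> u; apply/funext => i; rewrite /coords tnth_mktuple. Qed.

Lemma coordsK : cancel coords of_coords.
Proof.
move=> z; apply: eq_from_tnth => i; rewrite tnth_mktuple; apply: val_inj => /=.
by rewrite /coords prednK // (valP (tnth z i)).
Qed.

Lemma le_coords x y : x <= y <-> vle (coords x) (coords y).
Proof.
have le_coord i : (tnth x i <= tnth y i) = (coords x i <= coords y i)%N.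
  have -> : (tnth x i <= tnth y i) = (val (tnth x i) <= val (tnth y i))%N by [].
  rewrite /coords; move: (valP (tnth x i)) (valP (tnth y i)).
  by case: (val _) => [//|k] _; case: (val _).
rewrite leEtprod; split; first by move=> /forallP xy i; rewrite -le_coord.
by move=> xy; apply/forallP => i; rewrite le_coord.
Qed.

(* The permutation r of coordinates followed by the translation that takes the
   least element u of the domain to v. *)
Definition perm_shift (r : 'I_n -> 'I_n) u v z : option (posnat_pow n) :=
  if of_coords u <= z
  then Some (of_coords (fun j => coords z (r j) - u (r j) + v j)%N) else None.

(** The additive equation avoids truncated subtraction, so later goals reduce to linear
    arithmetic. *)
Lemma perm_shift_Some r u v z w : perm_shift r u v z = Some w <->
  vle u (coords z) /\
  forall j, (coords w j + u (r j) = coords z (r j) + v j)%N.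
Proof.
rewrite /perm_shift; case: ifPn => [|/negP] le; rewrite le_coords of_coordsK in le;
  last by split => // -[].
split => [[<-]|[_ zw]].
  by split=> // j; rewrite of_coordsK; have := le (r j); lia.
rewrite -[w]coordsK; congr (Some (of_coords _)).
by apply/funext => j; have := zw j; have := le (r j); lia.
Qed.

Lemma perm_shift_iso r u v :
  bijective r -> principal_filter_iso (perm_shift r u v).
Proof.
move=> [s rs sr]; exists (of_coords u), (of_coords v); split.
- apply/seteqP; split => z; rewrite /pdom /principal_filter /= /perm_shift.
    by move=> [w]; case: ifP.
  by move=> ->; eexists.
- apply/seteqP; split => w; rewrite /pran /principal_filter /=.
    move=> [z /perm_shift_Some[uz zw]]; apply/le_coords => j.
    by rewrite of_coordsK; have := uz (r j); have := zw j; lia.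
  move/le_coords; rewrite of_coordsK => vw.
  exists (of_coords (fun i => coords w (s i) - v (s i) + u i)%N).
  apply/perm_shift_Some; rewrite of_coordsK; split=> [i|j]; first by lia.
  by rewrite rs; have := vw j; lia.
- move=> z1 z2 w /perm_shift_Some[_ e1] /perm_shift_Some[_ e2].
  rewrite -[z1]coordsK -[z2]coordsK; congr of_coords; apply/funext => i.
  by have := e1 (s i); have := e2 (s i); rewrite sr; lia.
- move=> z1 z2 w1 w2 /perm_shift_Some[_ e1] /perm_shift_Some[_ e2].
  apply/idP/idP => /le_coords le; apply/le_coords.
    by move=> j; have := e1 j; have := e2 j; have := le (r j); lia.
  by move=> i; have := e1 (s i); have := e2 (s i); have := le (s i); rewrite sr; lia.
Qed.

(** Measuring arguments from [x] and values from [y] turns [f] into an automorphism of the vectors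
    of natural numbers, to which [vector_automorphism_perm] applies. *)
Lemma IPF_perm_shift f : exists r u v,
  bijective r /\ forall z, f z = perm_shift r u v z.
Proof.
have [x [y [df rf If Of]]] := ipf_mapP f.
pose add t := of_coords (fun i => coords x i + t i)%N.
have : forall t, exists w, f (add t) = Some w.
  move=> t; have : pdom f (add t); last by [].
  rewrite df /principal_filter /=; apply/le_coords => i.
  by rewrite of_coordsK leq_addr.
move/choice => [F fF].
have Fy t : vle (coords y) (coords (F t)).
  apply/le_coords; have : pran f (F t) by exists (add t).
  by rewrite rf.
have Fle t t' : vle t t' <-> F t <= F t'.
  rewrite -(Of _ _ _ _ (fF t) (fF t')) le_coords !of_coordsK.
  by split => le i; have := le i; rewrite leq_add2l.
have [t t'|t|r r_bij gr] :=
    @vector_automorphism_perm n (fun t i => coords (F t) i - coords y i)%N.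
- rewrite Fle le_coords; split => le i; have := le i; first by lia.
  by have := Fy t i; have := Fy t' i; lia.
- have : pran f (of_coords (fun i => coords y i + t i)%N).
    rewrite rf /principal_filter /=; apply/le_coords => i.
    by rewrite of_coordsK leq_addr.
  move=> [z fz]; exists (fun i => coords z i - coords x i)%N.
  have : pdom f z by eexists; exact: fz.
  rewrite df => /le_coords xz.
  have := fF (fun i => coords z i - coords x i)%N.
  have -> : add (fun i => coords z i - coords x i)%N = z.
    rewrite -[RHS]coordsK; congr of_coords; apply/funext => i.
    by have := xz i; lia.
  by rewrite fz => -[<-]; apply/funext => i; rewrite of_coordsK; lia.
exists r, (coords x), (coords y); split=> // z; case fz : (f z) => [w|]; last first.
  rewrite /perm_shift coordsK; case: ifP => // xz.
  have : pdom f z by rewrite df.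
  by move=> [w]; rewrite fz.
apply/esym/perm_shift_Some.
have : pdom f z by eexists; exact: fz.
rewrite df => /le_coords xz; split=> // j.
pose t i := (coords z i - coords x i)%N.
have addt : add t = z.
  rewrite -[RHS]coordsK; congr of_coords; apply/funext => i.
  by rewrite /t; have := xz i; lia.
have := fF t; rewrite addt fz => -[->].
by have := gr t j; have := Fy t j; have := xz (r j); rewrite /t; lia.
Qed.

Lemma perm_shift_agree r u v r' u' v' z0 :
  (forall z, z0 <= z -> exists2 w, perm_shift r u v z = Some w &
                                   perm_shift r' u' v' z = Some w) ->
  r = r' /\ forall j, (v j + u' (r j) = v' j + u (r j))%N.
Proof.
move=> agree; have [w0 /perm_shift_Some[_ e0] /perm_shift_Some[_ e0']] :=
  agree _ (lexx z0).
have rr' : r = r'.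
  apply/funext => j; apply/eqP/negPn/negP => rj.
  (* Raising coordinate [r j] by one changes entry [j] of the first image but not of the second when
     [r' j] differs from [r j]. *)
  pose z := of_coords (fun i => coords z0 i + (i == r j))%N.
  have /agree[w /perm_shift_Some[_ e] /perm_shift_Some[_ e']] : z0 <= z.
    by apply/le_coords => i; rewrite of_coordsK leq_addr.
  have := e j; have := e' j; have := e0 j; have := e0' j.
  by rewrite !of_coordsK eqxx eq_sym (negPf rj); lia.
by subst r'; split=> // j; have := e0 j; have := e0' j; lia.
Qed.

Lemma Cmg_greatest a : exists m, natural_greatest [set t | Cmg a t] m.
Proof.
have [r [u [v [r_bij aE]]]] := IPF_perm_shift a.
have [s rs sr] := r_bij.
(* u0 is the least vector whose translate by v - u has no negative entry. *)
pose u0 i := (u i - v (s i))%N; pose v0 j := (v j - u (r j))%N.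
pose m := MkIPF (perm_shift_iso u0 v0 r_bij).
(* Equal translations give [u i - v (s i) = u' i - v' (s i)] over the integers, which is at most
   [u' i]; hence [u0] lies below [u'] and [m] extends [b]. *)
have ext b r' u' v' : (forall z, b z = perm_shift r' u' v' z) -> r = r' ->
    (forall j, v j + u' (r j) = v' j + u (r j))%N -> natural_le b m.
  move=> bE rr' uv; subst r'; apply: extension_natural_le => z w.
  rewrite bE => /perm_shift_Some[uz zw]; apply/perm_shift_Some; split=> [i|j].
    by rewrite /u0; have := uz i; have := uv (s i); rewrite sr; lia.
  by rewrite /u0 /v0 rs; have := uv j; have := zw j; lia.
exists m; split.
  (* From [a = m * e] with [e] idempotent follows [a * e = m * e], so [m] lies in the class of
     [a]. *)
  have [e ee am] := ext a r u v aE erefl (fun=> erefl).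
  by exists e; rewrite // am -mulgA ee.
move=> b /Cmg_agree[z0 ab].
have [r' [u' [v' [_ bE]]]] := IPF_perm_shift b.
have [|rr' uv] := @perm_shift_agree r u v r' u' v' z0.
  by move=> z /ab; rewrite aE bE.
exact: ext bE rr' uv.
Qed.

End PositivePowers.

Theorem proposition2p25 (n : nat) (hn : (0 < n)%N) :
  F_inverse_semigroup (IPF (posnat_pow n)).
Proof. by split; [exact: IPF_inverse_semigroup | exact: Cmg_greatest]. Qed.
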